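(* Let $n\ge 2$, let $\mathscr{C}_H\subseteq\mathbb{F}_2^{2^n-1}$ be the $[2^n-1,\,2^n-1-n,\,3]$ Hamming code, and let $\mathcal{C}_e$, $\mathcal{C}_o$ be its subsets of even-weight and odd-weight codewords, with orderings $\mathbf{v}_1,\ldots,\mathbf{v}_{|\mathcal{C}_e|}$ of $\mathcal{C}_e$ and $\mathbf{w}_1,\ldots,\mathbf{w}_{|\mathcal{C}_o|}$ of $\mathcal{C}_o$. Let $A$ and $A'$ be the adjacency matrices, with respect to these orderings, of the graphs on $\mathcal{C}_e$ and $\mathcal{C}_o$, respectively, in which two vertices are adjacent iff their Hamming distance is $4$. Fix $\mathbf{w}'\in\mathcal{C}_o$ and let $P$ be the permutation matrix with $P_{ik}=1$ if $\mathbf{w}_i=\mathbf{v}_k\oplus\mathbf{w}'$ and $0$ otherwise. For $\mathbf{u}\in\mathbb{F}_2^{2^n-1}$ let $\mathbf{e}_{\mathbf{u}}=[(-1)^{\mathbf{u}\cdot\mathbf{v}_1},\ldots,(-1)^{\mathbf{u}\cdot\mathbf{v}_{|\mathcal{C}_e|}}]^\top$, let $\mathcal{Q}=\{\mathbf{e}_{\mathbf{u}}\mid\mathbf{u}\in\mathbb{F}_2^{2^n-1}\}$ (a set of orthogonal eigenvectors of $A$), and let $\lambda_{\min}$ be the minimum eigenvalue of $A$ (equivalently of $A'$). Let $\mathcal{Q}'=\{P\mathbf{e}_{\mathbf{u}}\mid\mathbf{e}_{\mathbf{u}}\in\mathcal{Q}\}$ be the set of orthogonal eigenvectors of $A'$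 obtained by applying $P$ to each element of $\mathcal{Q}$. Then any $\mathbf{e}_{\mathbf{u}}'\in\mathcal{Q}'$ corresponding to the eigenvalue $\lambda_{\min}$, and likewise its negative $-\mathbf{e}_{\mathbf{u}}'$, is a valid cut vector $\mathbf{z}\in\{+1,-1\}^{|\mathcal{C}_o|}$ and minimizes $\mathbf{z}^\top A'\mathbf{z}$ over $\{+1,-1\}^{|\mathcal{C}_o|}$. Such vectors yield an optimal parity assignment for $\mathcal{C}_o$: for $\{\mathbf{p}',\overline{\mathbf{p}'}\}\in\{P_e,P_o\}$, the assignment giving $\mathbf{w}_i$ the parity $\mathbf{p}'$ if $z_i=+1$ and $\overline{\mathbf{p}'}$ if $z_i=-1$ is optimal for $\mathcal{C}_o$.
   Context: The $[2^n-1,\,2^n-1-n,\,3]$ Hamming code is the kernel over $\mathbb{F}_2$ of an $n\times(2^n-1)$ matrix whose columns are all the nonzero vectors of $\mathbb{F}_2^n$, each appearing once; every non-codeword is at Hamming distance $1$ from exactly one codeword. $\oplus$ is addition and $\mathbf{u}\cdot\mathbf{v}$ the inner product over $\mathbb{F}_2$; an overline on a bit vector denotes bitwise complement. Let $P_e=\{00,11\}$ and $P_o=\{01,10\}$, and let $\{R,R'\}=\{P_e,P_o\}$. Given parity assignments $a:\mathcal{C}_e\to R$ and $b:\mathcal{C}_o\to R'$, let $\mathbf{p}_{a,b}:\mathbb{F}_2^{2^n-1}\to\mathbb{F}_2^2$ equal $a$ on $\mathcal{C}_e$, $b$ on $\mathcal{C}_o$, and on a non-codeword equal the bitwise complement of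 the parity of its unique nearest codeword. Let $\mathrm{Enc}_{a,b}(\mathbf{x})=(\mathbf{x},\mathbf{p}_{a,b}(\mathbf{x}))$ and let $N_2(a,b)$ be the number of unordered pairs of distinct $\mathbf{x},\mathbf{y}\in\mathbb{F}_2^{2^n-1}$ with $d_H(\mathrm{Enc}_{a,b}(\mathbf{x}),\mathrm{Enc}_{a,b}(\mathbf{y}))=2$, where $d_H$ is Hamming distance. A parity assignment $b:\mathcal{C}_o\to R'$ is optimal for $\mathcal{C}_o$ if $N_2(a,b)\le N_2(a,b')$ for all $b':\mathcal{C}_o\to R'$ and all $a:\mathcal{C}_e\to R$. *)

(* Defs.v *)
From HB Require Import structures.
From mathcomp Require Import all_boot all_order all_algebra.
From mathcomp Require Import classical_sets reals.

Set Implicit Arguments.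
Unset Strict Implicit.
Unset Printing Implicit Defensive.

Import Order.TTheory GRing.Theory Num.Theory.
Local Open Scope ring_scope.

Definition dH (N : nat) (x y : 'rV['F_2]_N) : nat :=
  #|[set i | x 0 i != y 0 i]|.

Definition weight (N : nat) (x : 'rV['F_2]_N) : nat :=
  #|[set i | x 0 i != 0]|.

Definition dotF2 (N : nat) (u v : 'rV['F_2]_N) : 'F_2 :=
  \sum_(i < N) u 0 i * v 0 i.

Definition bcompl (N : nat) (x : 'rV['F_2]_N) : 'rV['F_2]_N :=
  \row_i (x 0 i + 1).

Definition hamming_check (n : nat) (H : 'M['F_2]_(n, 2 ^ n - 1)) : Prop :=
  (forall j, col j H != 0) /\
  (forall c : 'cV['F_2]_n, c != 0 -> exists! j, col j H = c).

Definition code (n N : nat) (H : 'M['F_2]_(n, N)) : {set 'rV['F_2]_N} :=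
  [set x | H *m x^T == 0].

Definition even_part (N : nat) (C : {set 'rV['F_2]_N}) : {set 'rV['F_2]_N} :=
  [set x in C | ~~ odd (weight x)].

Definition odd_part (N : nat) (C : {set 'rV['F_2]_N}) : {set 'rV['F_2]_N} :=
  [set x in C | odd (weight x)].

Definition ordering_of (N : nat) (D : {set 'rV['F_2]_N})
    (v : 'I_#|D| -> 'rV['F_2]_N) : Prop :=
  injective v /\ [set v i | i : 'I_#|D|] = D.

Definition Pe : {set 'rV['F_2]_2} := [set const_mx 0; const_mx 1].
Definition Po : {set 'rV['F_2]_2} :=
  [set \row_i (i == 0)%:R; \row_i (i != 0)%:R].

(* Parity assignments are total functions, constrained (and used) only on the
   relevant codewords. *)
Definition assignment (N : nat) (D : {set 'rV['F_2]_N})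
    (S : {set 'rV['F_2]_2}) (a : 'rV['F_2]_N -> 'rV['F_2]_2) : Prop :=
  forall c, c \in D -> a c \in S.

(* For a Hamming code the minimizer is unique.  The zero word, which lies in
   every linear code, is only the witness that C is nonempty. *)
Definition nearest (N : nat) (C : {set 'rV['F_2]_N}) (x : 'rV['F_2]_N) :
    'rV['F_2]_N :=
  [arg min_(c < (0 : 'rV['F_2]_N) in C) dH x c].

Definition code_parity (N : nat) (C : {set 'rV['F_2]_N})
    (a b : 'rV['F_2]_N -> 'rV['F_2]_2) (c : 'rV['F_2]_N) : 'rV['F_2]_2 :=
  if c \in even_part C then a c else b c.

Definition parity (N : nat) (C : {set 'rV['F_2]_N})
    (a b : 'rV['F_2]_N -> 'rV['F_2]_2) (x : 'rV['F_2]_N) : 'rV['F_2]_2 :=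
  if x \in C then code_parity C a b x
  else bcompl (code_parity C a b (nearest C x)).

Definition Enc (N : nat) (C : {set 'rV['F_2]_N})
    (a b : 'rV['F_2]_N -> 'rV['F_2]_2) (x : 'rV['F_2]_N) : 'rV['F_2]_(N + 2) :=
  row_mx x (parity C a b x).

Definition N2 (N : nat) (C : {set 'rV['F_2]_N})
    (a b : 'rV['F_2]_N -> 'rV['F_2]_2) : nat :=
  #|[set U : {set 'rV['F_2]_N} | [exists x, exists y,
      [&& x != y, U == [set x; y] & dH (Enc C a b x) (Enc C a b y) == 2%N]]]|.

Definition optimal_odd (N : nat) (C : {set 'rV['F_2]_N})
    (S S' : {set 'rV['F_2]_2}) (b : 'rV['F_2]_N -> 'rV['F_2]_2) : Prop :=
  assignment (odd_part C) S' b /\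
  forall b' a, assignment (odd_part C) S' b' ->
    assignment (even_part C) S a -> (N2 C a b <= N2 C a b')%N.

Definition adj4 (R : realType) (N m : nat) (v : 'I_m -> 'rV['F_2]_N) : 'M[R]_m :=
  \matrix_(i, j) (dH (v i) (v j) == 4%N)%:R.

Definition shift_mx (R : realType) (N m m' : nat) (v : 'I_m -> 'rV['F_2]_N)
    (w : 'I_m' -> 'rV['F_2]_N) (w' : 'rV['F_2]_N) : 'M[R]_(m', m) :=
  \matrix_(i, k) (w i == v k + w')%:R.

Definition char_vec (R : realType) (N m : nat) (v : 'I_m -> 'rV['F_2]_N)
    (u : 'rV['F_2]_N) : 'cV[R]_m :=
  \col_k (-1) ^+ nat_of_ord (dotF2 u (v k)).

Definition orthogonal_eigenvectors (R : realType) (m : nat) (A : 'M[R]_m)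
    (Q : set 'cV[R]_m) : Prop :=
  (forall x, Q x -> x != 0 /\ exists mu : R, A *m x = mu *: x) /\
  (forall x y, Q x -> Q y -> x != y -> x^T *m y = 0).

Definition min_eigenvalue (R : realType) (m : nat) (A : 'M[R]_m) (l : R) : Prop :=
  eigenvalue A l /\ forall mu, eigenvalue A mu -> l <= mu.

Definition cut_vector (R : realType) (m : nat) (z : 'cV[R]_m) : Prop :=
  forall i, z i 0 = 1 \/ z i 0 = -1.

Definition qform (R : realType) (m : nat) (A : 'M[R]_m) (z : 'cV[R]_m) : R :=
  (z^T *m A *m z) 0 0.

(* Main.v *)
(* Translating by a codeword turns each of the two distance-4 graphs into a
   Cayley graph for the weight-4 codewords, so the characters
   x |-> (-1)^(u.x) are eigenvectors, with eigenvalue the sum of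
   (-1)^(u.c) over the weight-4 codewords c.  Their completeness, summing over
   all u, shows that there are no other eigenvalues and that z^T A z is at least
   lambda_min times |z|^2, with equality at a +-1 eigenvector for lambda_min.

   For N_2, words whose nearest codewords c, c' are distinct and odd have
   encodings at distance 2 iff they are at distance 2 themselves and c, c'
   receive the same parity; this forces d(c, c') = 4, and each such ordered pair
   (c, c') accounts for 12 ordered pairs of words.  All other pairs of words
   contribute independently of b.  Hence minimizing N_2 over b amounts to
   minimizing the number of adjacent c, c' with equal parity, which is an
   increasing affine function of z^T A' z. *)
Require Import Defs.
From HB Require Import structures.
From mathcomp Require Import all_boot all_order all_algebra.
From mathcomp Require Import lra zify.
From mathcomp Require Import classical_sets reals.

Set Implicit Arguments.
Unset Strict Implicit.
Unset Printing Implicit Defensive.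

Import Order.TTheory GRing.Theory Num.Theory.
Local Open Scope ring_scope.

(** * Arithmetic over F_2 and Hamming weight *)

Lemma F2_neq0 (a : 'F_2) : (a != 0)%:R = a.
Proof. by apply/eqP; case: a => [[|[|?]] ?]. Qed.

Lemma addF2_eq0 (a b : 'F_2) : (a + b == 0) = (a == b).
Proof. by case: a b => [[|[|?]] ?] [[|[|?]] ?]. Qed.

Lemma addF2_neq0 (a b : 'F_2) : (a + b != 0) = (a != 0) (+) (b != 0).
Proof. by case: a b => [[|[|?]] ?] [[|[|?]] ?]. Qed.

Lemma rVF2_addrr (N : nat) (x : 'rV['F_2]_N) : x + x = 0.
Proof. by apply/rowP => i; rewrite !mxE; apply/eqP; rewrite addF2_eq0. Qed.

Lemma rVF2_addrK (N : nat) (x y : 'rV['F_2]_N) : x + (x + y) = y.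
Proof. by rewrite addrA rVF2_addrr add0r. Qed.

(** Modulo 2 the weight is a linear form. This makes weight parity additive, hence splits the code
    into its even and odd parts. *)
Lemma weight_natr (N : nat) (x : 'rV['F_2]_N) :
  (weight x)%:R = \sum_i x 0 i :> 'F_2.
Proof.
rewrite /weight cardsE -sum1_card natr_sum big_mkcond.
by apply: eq_bigr => i _; rewrite -[RHS]F2_neq0 -topredE /=; case: eqP.
Qed.

Lemma odd_weight (N : nat) (x : 'rV['F_2]_N) :
  odd (weight x) = (\sum_i x 0 i != 0).
Proof.
rewrite -weight_natr; elim: (weight x) => [|k IH] //=.
by rewrite IH mulrSr addF2_neq0 addbT.
Qed.

Lemma odd_weightD (N : nat) (x y : 'rV['F_2]_N) :
  odd (weight (x + y)) = odd (weight x) (+) odd (weight y).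
Proof.
rewrite !odd_weight (eq_bigr (fun i => x 0 i + y 0 i)) ?big_split /=; last first.
  by move=> i _; rewrite mxE.
exact: addF2_neq0.
Qed.

Lemma dHE (N : nat) (x y : 'rV['F_2]_N) : dH x y = weight (x + y).
Proof. by apply: eq_card => i; rewrite !inE mxE addF2_eq0. Qed.

Lemma dHC (N : nat) (x y : 'rV['F_2]_N) : dH x y = dH y x.
Proof. by rewrite !dHE addrC. Qed.

Lemma weight_eq0 (N : nat) (x : 'rV['F_2]_N) : (weight x == 0%N) = (x == 0).
Proof.
rewrite cards_eq0; apply/eqP/eqP => [/setP x0|->].
  by apply/rowP => i; move: (x0 i); rewrite !inE mxE => /negbFE/eqP.
by apply/setP => i; rewrite !inE mxE eqxx.
Qed.

Lemma dH_eq0 (N : nat) (x y : 'rV['F_2]_N) : (dH x y == 0%N) = (x == y).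
Proof.
rewrite dHE weight_eq0; apply/eqP/eqP => [e|->]; last exact: rVF2_addrr.
by rewrite -[y](rVF2_addrK x) e addr0.
Qed.

Lemma weightD (N : nat) (x y : 'rV['F_2]_N) :
  (weight (x + y) <= weight x + weight y)%N.
Proof.
apply: leq_trans (leq_card_setU _ _); apply/subset_leq_card/fintype.subsetP => i.
rewrite !inE mxE; case: (x 0 i =P 0) => [->|//]; by rewrite add0r.
Qed.

Lemma dH_triangle (N : nat) (x y z : 'rV['F_2]_N) : (dH x z <= dH x y + dH y z)%N.
Proof. by rewrite !dHE; apply: leq_trans (weightD _ _); rewrite -addrA rVF2_addrK. Qed.

Lemma dH_sum (N : nat) (x y : 'rV['F_2]_N) :
  dH x y = (\sum_i (x 0%R i != y 0%R i))%N.
Proof.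
rewrite /dH cardsE -sum1_card big_mkcond.
by apply: eq_bigr => i _; rewrite -topredE /=; case: eqP.
Qed.

Lemma dH_row_mx (N M : nat) (x y : 'rV['F_2]_N) (p q : 'rV['F_2]_M) :
  dH (row_mx x p) (row_mx y q) = (dH x y + dH p q)%N.
Proof.
rewrite !dH_sum big_split_ord /=.
by congr addn; apply: eq_bigr => i _; rewrite ?row_mxEl ?row_mxEr.
Qed.

Lemma delta_rowE (N : nat) (i j : 'I_N) : (delta_mx 0 i : 'rV['F_2]_N) 0 j = (j == i)%:R.
Proof. by rewrite mxE eqxx. Qed.

Lemma weight_delta (N : nat) (i : 'I_N) : weight (delta_mx 0 i : 'rV['F_2]_N) = 1%N.
Proof.
transitivity #|[set i]|; last exact: cards1.
apply: eq_card => j; rewrite !inE delta_rowE.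
by case: (j == i).
Qed.

Lemma weight_eq1 (N : nat) (x : 'rV['F_2]_N) :
  weight x = 1%N -> exists i, x = delta_mx 0 i.
Proof.
move/eqP/cards1P => [i /setP xi]; exists i; apply/rowP => j.
by rewrite delta_rowE -[LHS]F2_neq0; move: (xi j); rewrite !inE => ->.
Qed.

Lemma weight_eq2 (N : nat) (x : 'rV['F_2]_N) :
  weight x = 2%N -> exists i j, i != j /\ x = delta_mx 0 i + delta_mx 0 j.
Proof.
move/eqP/cards2P => [i [j [ij /setP xij]]]; exists i, j; split=> //.
apply/rowP => k; rewrite mxE !delta_rowE -[LHS]F2_neq0; move: (xij k); rewrite !inE => ->.
case: (k =P i) => [->|_]; last by rewrite add0r; case: (k == j).
by rewrite orTb (negbTE ij) addr0.
Qed.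

(** * Geometry of the Hamming code *)

Lemma codeP (n N : nat) (H : 'M['F_2]_(n, N)) x : reflect (H *m x^T = 0) (x \in code H).
Proof. by rewrite inE; apply: eqP. Qed.

Lemma codeD (n N : nat) (H : 'M['F_2]_(n, N)) x y :
  x \in code H -> (x + y \in code H) = (y \in code H).
Proof. by move/codeP => Hx; rewrite !inE linearD mulmxDr Hx add0r. Qed.

Lemma mem0_code (n N : nat) (H : 'M['F_2]_(n, N)) : 0 \in code H.
Proof. by apply/codeP; rewrite trmx0 mulmx0. Qed.

Lemma mulmx_delta_tr (n N : nat) (H : 'M['F_2]_(n, N)) i :
  H *m (delta_mx 0 i)^T = col i H.
Proof. by rewrite trmx_delta colE. Qed.

(** A word of weight 1 has a column of [H] as syndrome, and a word of weight 2 the sum of two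
    distinct columns. Columns are nonzero and pairwise distinct, so neither syndrome vanishes. *)
Lemma hamming_weight (n : nat) (H : 'M['F_2]_(n, 2 ^ n - 1)) c :
  hamming_check H -> c \in code H -> (weight c <= 2)%N -> c = 0.
Proof.
move=> [H0 H1] /codeP Hc; rewrite leq_eqVlt => /orP[/eqP/weight_eq2|].
  move=> [i [j [ij cE]]]; move: Hc; rewrite cE linearD mulmxDr !mulmx_delta_tr => e.
  have eji : col j H = col i H.
    have : (col i H + col j H)^T = 0 by rewrite e trmx0.
    rewrite linearD => /(congr1 (+%R (col i H)^T)); rewrite addr0.
    by rewrite rVF2_addrK => /trmx_inj.
  have [k [_ uk]] := H1 _ (H0 i).
  by move: ij; rewrite -(uk _ (erefl _)) -(uk _ eji) eqxx.
rewrite ltnS leq_eqVlt => /orP[/eqP/weight_eq1 [i cE]|].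
  by have := H0 i; rewrite -mulmx_delta_tr -cE Hc eqxx.
by rewrite ltnS leqn0 weight_eq0 => /eqP.
Qed.

Lemma hamming_dH (n : nat) (H : 'M['F_2]_(n, 2 ^ n - 1)) c c' :
  hamming_check H -> c \in code H -> c' \in code H -> (dH c c' <= 2)%N -> c = c'.
Proof.
move=> hH Cc Cc'; rewrite dHE => /(hamming_weight hH); rewrite codeD// => /(_ Cc') e.
by apply/eqP; rewrite -dH_eq0 dHE e weight_eq0.
Qed.

(** The code is perfect: the syndrome of a non-codeword is some column [i], and flipping coordinate
    [i] cancels it. *)
Lemma hamming_cover (n : nat) (H : 'M['F_2]_(n, 2 ^ n - 1)) x :
  hamming_check H -> exists2 c, c \in code H & (dH x c <= 1)%N.
Proof.
move=> [_ H1]; have [xC|] := boolP (x \in code H).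
  by exists x => //; have /eqP -> : dH x x == 0%N by rewrite dH_eq0.
rewrite inE => /H1[i [xi _]]; exists (x + delta_mx 0 i); last first.
  by rewrite dHE rVF2_addrK weight_delta.
apply/codeP; rewrite linearD mulmxDr mulmx_delta_tr xi -mulmxDr -linearD /=.
by rewrite rVF2_addrr trmx0 mulmx0.
Qed.

(** Two codewords within distance 1 of [x] are within distance 2 of each other, hence equal. The
    fibres of [nearest] are therefore the radius-1 balls around codewords, the form in which the
    counting uses them. *)
Lemma nearestE (n : nat) (H : 'M['F_2]_(n, 2 ^ n - 1)) x c :
  hamming_check H -> (nearest (code H) x == c) = (c \in code H) && (dH x c <= 1)%N.
Proof.
move=> hH; rewrite /nearest; case: arg_minnP => [|c0 Cc0 minc0]; first exact: mem0_code.
have c01 : (dH x c0 <= 1)%N.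
  by have [c1 Cc1 d1] := hamming_cover x hH; apply: leq_trans (minc0 _ Cc1) d1.
apply/eqP/andP => [<- //|[Cc d1]]; apply: hamming_dH hH Cc0 Cc _.
by apply: leq_trans (dH_triangle _ x _) _; rewrite dHC (leq_add c01 d1).
Qed.

Lemma nearest_code (n : nat) (H : 'M['F_2]_(n, 2 ^ n - 1)) x :
  hamming_check H -> nearest (code H) x \in code H.
Proof.
by move=> hH; have := nearestE x (nearest (code H) x) hH; rewrite eqxx => /esym/andP[].
Qed.

Lemma nearest_id (n : nat) (H : 'M['F_2]_(n, 2 ^ n - 1)) x :
  hamming_check H -> x \in code H -> nearest (code H) x = x.
Proof.
move=> hH Cx; apply/eqP; rewrite nearestE// Cx.
by have /eqP -> : dH x x == 0%N by rewrite dH_eq0.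
Qed.

Lemma even_part_addr (n N : nat) (H : 'M['F_2]_(n, N)) x c :
  x \in even_part (code H) -> ~~ odd (weight c) ->
  (x + c \in even_part (code H)) = (c \in code H).
Proof.
rewrite !inE => /andP[Cx ex] ec; rewrite odd_weightD (negbTE ex) (negbTE ec) andbT.
by have := @codeD _ _ H x c; rewrite !inE; apply.
Qed.

Lemma odd_part_addr (n N : nat) (H : 'M['F_2]_(n, N)) x c :
  x \in odd_part (code H) -> ~~ odd (weight c) ->
  (x + c \in odd_part (code H)) = (c \in code H).
Proof.
rewrite !inE => /andP[Cx ex] ec; rewrite odd_weightD ex (negbTE ec) andbT.
by have := @codeD _ _ H x c; rewrite !inE; apply.
Qed.

(** * Spectrum of the distance-4 graph *)

Definition chi (R : realType) (N : nat) (u x : 'rV['F_2]_N) : R :=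
  (-1) ^+ nat_of_ord (dotF2 u x).

Lemma chiD (R : realType) N (u x y : 'rV['F_2]_N) :
  chi R u (x + y) = chi R u x * chi R u y.
Proof.
rewrite /chi -exprD.
have -> : dotF2 u (x + y) = dotF2 u x + dotF2 u y.
  by rewrite /dotF2 -big_split; apply: eq_bigr => i _; rewrite mxE mulrDr.
case: (dotF2 u x) (dotF2 u y) => [[|[|?]] ?] [[|[|?]] ?] //=.
by rewrite expr0 expr2 mulrNN mulr1.
Qed.

Lemma chiC (R : realType) N (u x : 'rV['F_2]_N) : chi R u x = chi R x u.
Proof. by rewrite /chi /dotF2; under eq_bigr => i _ do rewrite mulrC. Qed.

Lemma chi_pm1 (R : realType) N (u x : 'rV['F_2]_N) : chi R u x = 1 \/ chi R u x = -1.
Proof. by rewrite /chi -signr_odd; case: odd; [right|left]. Qed.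

Lemma chi_mulrr (R : realType) N (u x : 'rV['F_2]_N) : chi R u x * chi R u x = 1.
Proof. by case: (chi_pm1 R u x) => ->; rewrite ?mulrNN mulr1. Qed.

Lemma chi0 (R : realType) N (u : 'rV['F_2]_N) : chi R u 0 = 1.
Proof. by rewrite -(rVF2_addrr u) chiD chi_mulrr. Qed.

(** If coordinate [i] of [x] is nonzero, translating [u] by the [i]-th unit vector negates every
    term, so the sum equals its own opposite. *)
Lemma chi_sum (R : realType) N (x : 'rV['F_2]_N) :
  \sum_u chi R u x = (#|{: 'rV['F_2]_N}|)%:R * (x == 0)%:R.
Proof.
have [->|x0] := eqVneq x 0.
  by under eq_bigr => u _ do rewrite chi0; rewrite sumr_const mulr1.
have [i xi] : exists i, x 0 i != 0.
  by apply/rV0Pn.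
have chi_i : chi R (delta_mx 0 i) x = -1.
  have dot_i : dotF2 (delta_mx 0 i) x = x 0 i.
    rewrite /dotF2 (bigD1 i) //= big1 => [|j ji].
      by rewrite delta_rowE eqxx; apply: etrans (addr0 _) (mul1r _).
    by rewrite delta_rowE (negbTE ji) mul0r.
  by rewrite /chi dot_i; case: (x 0 i) xi => [[|[|?]] ?].
have : \sum_u chi R u x = - \sum_u chi R u x.
  rewrite -sumrN (reindex_inj (addrI (delta_mx 0 i : 'rV['F_2]_N))) /=.
  by apply: eq_bigr => u _; rewrite chiC chiD !(chiC _ x) chi_i mulN1r.
by move=> e; rewrite mulr0; lra.
Qed.

Lemma char_vecE (R : realType) N m (v : 'I_m -> 'rV['F_2]_N) u k :
  char_vec R v u k 0 = chi R u (v k).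
Proof. by rewrite mxE. Qed.

(** Completeness of the characters. The sum runs over all [u] of the ambient space, so a vector
    arising from several [u] is counted with multiplicity; this avoids choosing representatives. *)
Lemma char_vec_resolution (R : realType) N m (v : 'I_m -> 'rV['F_2]_N) :
  injective v ->
  \sum_u char_vec R v u *m (char_vec R v u)^T = (#|{: 'rV['F_2]_N}|)%:R%:M.
Proof.
move=> vI; apply/matrixP => i j; rewrite summxE.
transitivity (\sum_u chi R u (v i + v j)).
  apply: eq_bigr => u _; rewrite chiD -!char_vecE !mxE big_ord1.
  by rewrite !mxE.
rewrite chi_sum mxE -weight_eq0 -dHE dH_eq0 (inj_eq vI) mulr_natr.
by case: (i == j).
Qed.

Definition weight4_eigenvalue (R : realType) N (C : {set 'rV['F_2]_N})
    (u : 'rV['F_2]_N) : R :=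
  \sum_(c in C | weight c == 4%N) chi R u c.

(** Common abstraction of the even and odd parts: the neighbours of a vertex are its translates by
    the weight-4 words of [C]. Here [C] is the full code in both cases, so both graphs get the same
    eigenvalues. *)
Definition weight4_regular N m (C : {set 'rV['F_2]_N}) (v : 'I_m -> 'rV['F_2]_N) :=
  injective v /\
  forall i c, weight c = 4%N -> (v i + c \in [set v j | j : 'I_m]) = (c \in C).

Section Adjacency.
Variables (R : realType) (N m : nat) (C : {set 'rV['F_2]_N}).
Variables (v : 'I_m -> 'rV['F_2]_N) (vC : weight4_regular C v).

Let K : R := (#|{: 'rV['F_2]_N}|)%:R.

Let K_gt0 : 0 < K.
Proof. by rewrite ltr0n; apply/card_gt0P; exists 0. Qed.

Lemma adj4_char_vec u :
  adj4 R v *m char_vec R v u = weight4_eigenvalue R C u *: char_vec R v u.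
Proof.
have [vI vC4] := vC; apply/matrixP => i k; rewrite ord1 !mxE.
rewrite mulr_suml.
(* Substituting [v i + x] for the weight-4 codeword turns the right-hand sum into one over the
   neighbours [x] of [v i]. *)
rewrite (reindex_inj (addrI (v i))) /=.
transitivity (\sum_(x in [set v j | j : 'I_m])
    (if weight (v i + x) == 4%N then chi R u x else 0)).
  rewrite big_imset /=; last by move=> ? ? _ _; apply: vI.
  by apply: eq_bigr => j _; rewrite char_vecE mxE dHE; case: eqP; rewrite ?mul1r ?mul0r.
rewrite -big_mkcondr /=; apply: eq_big => [x|x _]; last first.
  by rewrite -[(-1) ^+ _]/(chi R u (v i)) -chiD addrC rVF2_addrK.
case: eqP => [/(vC4 i)|]; last by rewrite !andbF.
by rewrite rVF2_addrK => ->.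
Qed.

Lemma adj4_tr : (adj4 R v)^T = adj4 R v.
Proof. by apply/matrixP => i j; rewrite !mxE dHC. Qed.

Lemma char_vec_sqr u : (char_vec R v u)^T *m char_vec R v u = m%:R%:M.
Proof.
apply/matrixP => i j; rewrite !ord1 !mxE -[m in RHS]card_ord -sumr_const.
by apply: eq_bigr => k _; rewrite mxE char_vecE chi_mulrr.
Qed.

Lemma char_vec_neq0 u : (0 < m)%N -> char_vec R v u != 0.
Proof.
move=> m0; apply/eqP => e; have := char_vec_sqr u; rewrite e mulmx0.
move/matrixP/(_ 0 0)/eqP; rewrite !mxE eqxx mulr1n eq_sym pnatr_eq0.
by rewrite eqn0Ngt m0.
Qed.

Lemma adj4_resolution :
  K *: adj4 R v =
  \sum_u weight4_eigenvalue R C u *: (char_vec R v u *m (char_vec R v u)^T).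
Proof.
rewrite -mul_mx_scalar -(char_vec_resolution R vC.1) mulmx_sumr.
by apply: eq_bigr => u _; rewrite mulmxA adj4_char_vec scalemxAl.
Qed.

(** By completeness a nonzero row eigenvector [x] has nonzero product with some character vector.
    Evaluating [x A e_u] in two ways then identifies its eigenvalue with that of [e_u]. *)
Lemma eigenvalue_adj4P mu : (0 < m)%N ->
  eigenvalue (adj4 R v) mu <-> exists u, mu = weight4_eigenvalue R C u.
Proof.
move=> m0; split=> [/eigenvalueP [x xA x0]|[u ->]]; last first.
  apply/eigenvalueP; exists (char_vec R v u)^T.
    by rewrite -{1}adj4_tr -trmx_mul adj4_char_vec linearZ.
  by rewrite trmx_eq0 char_vec_neq0.
have [u xu] : exists u, x *m char_vec R v u != 0.
  apply/existsP; apply: contraNT x0; rewrite negb_exists => /forallP xu.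
  have : K *: x = 0.
    rewrite -mul_mx_scalar -(char_vec_resolution R vC.1) mulmx_sumr big1// => u _.
    by rewrite mulmxA (eqP (negbNE (xu u))) mul0mx.
  by move/eqP; rewrite scaler_eq0 (gt_eqF K_gt0).
exists u; apply/eqP; rewrite -subr_eq0.
have : (mu - weight4_eigenvalue R C u) *: (x *m char_vec R v u) = 0.
  by rewrite scalerBl scalemxAl -xA -mulmxA adj4_char_vec -scalemxAr subrr.
by move/eqP; rewrite scaler_eq0 (negbTE xu) orbF.
Qed.

Lemma min_eigenvalue_adj4P l : (0 < m)%N -> min_eigenvalue (adj4 R v) l <->
  (exists u, l = weight4_eigenvalue R C u) /\ forall u, l <= weight4_eigenvalue R C u.
Proof.
move=> m0; split=> [[/(eigenvalue_adj4P _ m0) el lmin]|[el lmin]].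
  by split=> // u; apply/lmin/eigenvalue_adj4P => //; exists u.
split; first exact/eigenvalue_adj4P.
by move=> mu /(eigenvalue_adj4P _ m0)[u ->].
Qed.

(** Rayleigh bound. With [f u] the inner product of [y] and [e_u], the two resolutions write [K]
    times the squared norm as the sum of the [f u ^+ 2], and [K] times the quadratic form as the
    same sum weighted by the eigenvalues. *)
Lemma qform_adj4_ge l (y : 'cV_m) : (forall u, l <= weight4_eigenvalue R C u) ->
  l * (y^T *m y) 0 0 <= qform (adj4 R v) y.
Proof.
move=> lmin; rewrite -(ler_pM2l K_gt0) mulrCA.
pose f u := (y^T *m char_vec R v u) 0 0.
have term u : (y^T *m (char_vec R v u *m (char_vec R v u)^T) *m y) 0 0 = f u ^+ 2.
  rewrite mulmxA -mulmxA -[(char_vec R v u)^T *m y]trmxK trmx_mul trmxK.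
  by rewrite mxE big_ord1 [X in _ * X]mxE.
have -> : K * (y^T *m y) 0 0 = \sum_u f u ^+ 2.
  transitivity ((y^T *m K%:M *m y) 0 0).
    by rewrite mul_mx_scalar -scalemxAl [RHS]mxE.
  rewrite -(char_vec_resolution R vC.1) mulmx_sumr mulmx_suml summxE.
  by apply: eq_bigr => u _; rewrite term.
have -> : K * qform (adj4 R v) y = \sum_u weight4_eigenvalue R C u * f u ^+ 2.
  transitivity ((y^T *m (K *: adj4 R v) *m y) 0 0).
    by rewrite -scalemxAr -scalemxAl [RHS]mxE.
  rewrite adj4_resolution mulmx_sumr mulmx_suml summxE.
  by apply: eq_bigr => u _; rewrite -scalemxAr -scalemxAl mxE term.
by rewrite mulr_sumr; apply: ler_sum => u _; rewrite ler_wpM2r// sqr_ge0.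
Qed.

End Adjacency.

Lemma cut_vector_sqr (R : realType) m (z : 'cV[R]_m) :
  cut_vector z -> (z^T *m z) 0 0 = m%:R.
Proof.
move=> cz; rewrite mxE -[m in RHS]card_ord -sumr_const.
by apply: eq_bigr => k _; rewrite mxE; case: (cz k) => ->; rewrite ?mulrNN mulr1.
Qed.

Lemma qform_eigen (R : realType) m (A : 'M[R]_m) (z : 'cV[R]_m) l :
  A *m z = l *: z -> qform A z = l * (z^T *m z) 0 0.
Proof. by move=> Az; rewrite /qform -mulmxA Az -scalemxAr mxE. Qed.

(** Choose a vertex [v k] at which the two characters differ, so their product there is -1. The
    vertex set is stable under translation by [v k], and that translation negates the inner
    product. *)
Lemma char_vec_orthogonal (R : realType) N m (v : 'I_m -> 'rV['F_2]_N) u t :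
  injective v ->
  (forall k x, (v k + x \in [set v i | i : 'I_m]) = (x \in [set v i | i : 'I_m])) ->
  char_vec R v u != char_vec R v t -> (char_vec R v u)^T *m char_vec R v t = 0.
Proof.
move=> vI vD ut.
have [k utk] : exists k, chi R u (v k) != chi R t (v k).
  apply/existsP; apply: contraNT ut; rewrite negb_exists => /forallP ut.
  by apply/eqP/matrixP => k j; rewrite !ord1 !char_vecE (eqP (negbNE (ut k))).
have utk1 : chi R u (v k) * chi R t (v k) = -1.
  move: utk; case: (chi_pm1 R u (v k)) => ->; case: (chi_pm1 R t (v k)) => ->;
  by rewrite ?eqxx // ?mulr1 ?mul1r.
apply/matrixP => i j; rewrite !ord1 !mxE.
pose g x := chi R u x * chi R t x.
have -> : \sum_k (char_vec R v u)^T 0 k * char_vec R v t k 0 =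
    \sum_(x in [set v i | i : 'I_m]) g x.
  rewrite big_imset /=; last by move=> ? ? _ _; apply: vI.
  by apply: eq_bigr => l _; rewrite mxE !char_vecE.
set S := \sum_(_ in _) _.
have : S = - S.
  rewrite {1}/S (reindex_inj (addrI (v k))) /= -sumrN.
  apply: eq_big => [x|x _]; first exact: vD.
  by rewrite /g !chiD mulrACA utk1 mulN1r.
by move=> e; lra.
Qed.

(** * Translation between even and odd codewords *)

Section Shift.
Variables (R : realType) (N m m' : nat).
Variables (v : 'I_m -> 'rV['F_2]_N) (w : 'I_m' -> 'rV['F_2]_N).
Variables (w' : 'rV['F_2]_N).
Hypotheses (vI : injective v) (wI : injective w).
Hypothesis vw : forall k, v k + w' \in [set w i | i : 'I_m'].
Hypothesis wv : forall i, w i + w' \in [set v k | k : 'I_m].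

(** Row [i] of the matrix selects the [k] with [w i = v k + w'], and [chi] is multiplicative. So
    [P e_u] is, up to one global sign, the character vector of [u] on the odd part. *)
Lemma shift_mx_char_vec u :
  shift_mx R v w w' *m char_vec R v u = chi R u w' *: char_vec R w u.
Proof.
apply/matrixP => i j; rewrite ord1 [LHS]mxE [RHS]mxE char_vecE.
have /imsetP[k _ wk] := wv i.
have wiE : w i = v k + w' by rewrite -wk addrC (addrC (w i)) rVF2_addrK.
rewrite (bigD1 k) //= big1 => [|l lk].
  by rewrite mxE char_vecE wiE eqxx mul1r addr0 -chiD (addrC (v k)) rVF2_addrK.
by rewrite mxE wiE (inj_eq (addIr w')) (inj_eq vI) eq_sym (negbTE lk) mul0r.
Qed.

Lemma shift_mx_isometry : (shift_mx R v w w')^T *m shift_mx R v w w' = 1%:M.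
Proof.
apply/matrixP => k l; rewrite !mxE.
have /imsetP[i _ wi] := vw k.
rewrite (bigD1 i) //= big1 => [|j ji].
  by rewrite !mxE -wi eqxx mul1r addr0 (inj_eq (addIr w')) (inj_eq vI).
by rewrite !mxE wi (inj_eq wI) (negbTE ji) mul0r.
Qed.

End Shift.

Section Parts.
Variables (n N : nat) (H : 'M['F_2]_(n, N)).
Let C := code H.

Lemma even_part_regular (v : 'I_#|even_part C| -> 'rV['F_2]_N) :
  ordering_of v -> weight4_regular C v.
Proof.
move=> [vI vE]; split=> // i c c4; rewrite vE even_part_addr ?c4//.
by rewrite -vE; apply: imset_f.
Qed.

Lemma odd_part_regular (w : 'I_#|odd_part C| -> 'rV['F_2]_N) :
  ordering_of w -> weight4_regular C w.
Proof.
move=> [wI wE]; split=> // i c c4; rewrite wE odd_part_addr ?c4//.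
by rewrite -wE; apply: imset_f.
Qed.

Lemma even_partD x y : x \in even_part C ->
  (x + y \in even_part C) = (y \in even_part C).
Proof.
rewrite !inE => /andP[Cx ex]; rewrite odd_weightD (negbTE ex).
by have := @codeD _ _ H x y; rewrite !inE => ->.
Qed.

Lemma addr_odd_part x y : y \in odd_part C ->
  (x + y \in odd_part C) = (x \in even_part C).
Proof.
rewrite addrC !inE => /andP[Cy oy]; rewrite odd_weightD oy.
by have := @codeD _ _ H y x; rewrite !inE => ->.
Qed.

Lemma addr_odd_part_even x y : y \in odd_part C ->
  (x + y \in even_part C) = (x \in odd_part C).
Proof.
rewrite addrC !inE => /andP[Cy oy]; rewrite odd_weightD oy negbK.
by have := @codeD _ _ H y x; rewrite !inE => ->.
Qed.
End Parts.

(** * Counting pairs of words at distance 2 *)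

(** Each unordered pair is the image of exactly two ordered ones. This converts the set count in
    [N2] into a double sum that can be split and reindexed. *)
Lemma card_edges (T : finType) (r : rel T) : symmetric r -> irreflexive r ->
  (#|[set U : {set T} | [exists x, exists y, [&& x != y, U == [set x; y] & r x y]]]|
   * 2)%N = (\sum_x \sum_y r x y)%N.
Proof.
move=> rS rI; rewrite pair_big /=.
transitivity (\sum_(p : T * T | r p.1 p.2) 1)%N; last first.
  by rewrite big_mkcond; apply: eq_bigr => p _; case: (r _ _).
set E := [set U | _].
rewrite (partition_big (fun p : T * T => [set p.1; p.2]) (mem E)) /=; last first.
  move=> [x y] /= rxy; rewrite inE; apply/existsP; exists x; apply/existsP; exists y.
  by rewrite eqxx rxy !andbT; apply: contraTneq rxy => ->; rewrite rI.
rewrite -sum_nat_const; apply: eq_bigr => U; rewrite inE.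
move=> /existsP[x /existsP[y /and3P[xy /eqP -> rxy]]].
transitivity #|[set (x, y); (y, x)]|.
  by rewrite cards2 xpair_eqE negb_and xy.
rewrite -sum1_card; apply: eq_bigl => -[z t] /=; rewrite !inE !xpair_eqE.
apply/orP/andP => [[] /andP[/eqP -> /eqP ->]|[rzt /eqP/setP e]].
- by rewrite rxy eqxx.
- by rewrite rS rxy finset.setUC eqxx.
have zt : z != t by apply: contraTneq rzt => ->; rewrite rI.
move: (e z) (e t); rewrite !inE !eqxx orbT /=.
move=> /esym/orP[]/eqP zE /esym/orP[]/eqP tE; move: zt; rewrite zE tE ?eqxx //.
  by left.
by right.
Qed.

Lemma weightD_delta N (x : 'rV['F_2]_N) i : weight (x + delta_mx 0 i) =
  if x 0 i != 0 then (weight x).-1 else (weight x).+1.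
Proof.
case: ifPn => xi; last first.
  transitivity #|i |: [set j | x 0 j != 0]|.
    apply: eq_card => j; rewrite !inE mxE addF2_neq0 delta_rowE.
    case: (j =P i) => [->|_]; first by rewrite (negbTE xi).
    by rewrite addbF.
  by rewrite cardsU1 inE xi.
transitivity #|[set j | x 0 j != 0] :\ i|.
  apply: eq_card => j; rewrite !inE mxE addF2_neq0 delta_rowE.
  case: (j =P i) => [->|_]; first by rewrite xi.
  by rewrite addbF.
by rewrite /weight [in RHS](cardsD1 i) inE xi.
Qed.

Lemma delta_inj N : injective (fun i : 'I_N => delta_mx 0 i : 'rV['F_2]_N).
Proof.
by move=> i j /rowP/(_ i); rewrite !delta_rowE eqxx; case: eqP.
Qed.

Lemma sum_weight_le1 N (F : 'rV['F_2]_N -> nat) :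
  (\sum_(s | (weight s <= 1)%N) F s = F 0%R + \sum_i F (delta_mx 0%R i))%N.
Proof.
have w0 : weight (0 : 'rV['F_2]_N) = 0%N by apply/eqP; rewrite weight_eq0.
rewrite (bigD1 0) ?w0 //=; congr addn.
rewrite -(big_imset F (in2W (@delta_inj N))) /=.
apply: eq_bigl => s; rewrite -weight_eq0; apply/andP/imsetP => [[s1 s0]|[i _ ->]].
  have /weight_eq1[i ->] : weight s = 1%N by lia.
  by exists i.
by rewrite weight_delta.
Qed.

(** From weight at least 3, one flip reaches weight 2 only if the weight is exactly 3 and the flip
    hits one of the 3 support positions. *)
Lemma count_weight2 N (x : 'rV['F_2]_N) : (2 < weight x)%N ->
  (\sum_(t : 'rV['F_2]_N | weight t <= 1) (weight (x + t)%R == 2) =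
   3 * (weight x == 3))%N.
Proof.
move=> x3; rewrite sum_weight_le1 addr0 (_ : (weight x == 2%N) = false) ?add0n; last by lia.
under eq_bigr => i _ do rewrite weightD_delta.
have [x3'|x3'] := eqVneq (weight x) 3%N; last first.
  by rewrite muln0 big1// => i _; case: ifP => _; lia.
rewrite x3' muln1 -[RHS]x3' /weight -sum1dep_card [in RHS]big_mkcond /=.
by apply: eq_bigr => i _; case: ifP.
Qed.

(** An even weight above 2 is at least 4, so two flips reach weight 2 only from weight 4: 4 choices
    for the first flip and 3 for the second give the 12. Applied with [d] the sum of two distinct
    odd codewords. *)
Lemma count_weight4 N (d : 'rV['F_2]_N) : (2 < weight d)%N -> ~~ odd (weight d) ->
  (\sum_(s : 'rV['F_2]_N | weight s <= 1) \sum_(t : 'rV['F_2]_N | weight t <= 1)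
     (weight (d + s + t)%R == 2) = 12 * (weight d == 4))%N.
Proof.
move=> d3 de.
have d4 : (3 < weight d)%N.
  by rewrite ltn_neqAle d3 andbT; apply: contraNneq de => <-.
have dD s : (weight s <= 1)%N -> (2 < weight (d + s)%R)%N.
  move=> s1; have := weightD (d + s) s.
  by rewrite -addrA (rVF2_addrr s) addr0; lia.
under eq_bigr => s s1 do rewrite count_weight2 ?dD//.
rewrite -big_distrr /= sum_weight_le1 addr0.
rewrite (_ : (weight d == 3%N) = false) ?add0n; last by lia.
under eq_bigr => i _ do rewrite weightD_delta.
have [d4'|d4'] := eqVneq (weight d) 4%N; last first.
  by rewrite muln0 big1 ?muln0// => i _; case: ifP => _; lia.
rewrite d4' muln1 -[12%N]/(3 * 4)%N; congr muln.
rewrite -[RHS]d4' /weight -sum1dep_card [in RHS]big_mkcond /=.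
by apply: eq_bigr => i _; case: ifP.
Qed.

(** * Two-bit parities and their classes *)

Lemma rV2P (p q : 'rV['F_2]_2) : p 0 0 = q 0 0 -> p 0 1 = q 0 1 -> p = q.
Proof.
move=> e0 e1; apply/rowP => -[[|[|//]] i2].
  by rewrite (_ : Ordinal i2 = 0) //; apply: val_inj.
by rewrite (_ : Ordinal i2 = 1) //; apply: val_inj.
Qed.

Lemma F2P (a : 'F_2) : a = 0 \/ a = 1.
Proof. by case: a => [[|[|//]] a2]; [left|right]; apply: val_inj. Qed.

Lemma mem_Pe (p : 'rV['F_2]_2) : (p \in Pe) = (p 0 0 == p 0 1).
Proof.
rewrite !inE; apply/orP/eqP => [[]/eqP->|e]; rewrite ?mxE//.
by case: (F2P (p 0 0)) => p0; [left|right]; apply/eqP/rV2P; rewrite mxE -?e.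
Qed.

Lemma mem_Po (p : 'rV['F_2]_2) : (p \in Po) = (p \notin Pe).
Proof.
rewrite mem_Pe !inE; apply/orP/idP => [[]/eqP->|]; rewrite ?mxE//.
case: (F2P (p 0 0)) (F2P (p 0 1)) => p0 [] p1; rewrite p0 p1 ?eqxx// => _;
  [right|left]; apply/eqP/rV2P; rewrite mxE ?p0 ?p1; exact: val_inj.
Qed.

Lemma dH_rV2 (p q : 'rV['F_2]_2) :
  dH p q = ((p 0%R 0%R != q 0%R 0%R) + (p 0%R 1%R != q 0%R 1%R))%N.
Proof.
rewrite dH_sum !big_ord_recl big_ord0 addn0.
by rewrite (_ : lift ord0 ord0 = 1) //; apply: val_inj.
Qed.

Lemma dH_parity (p q : 'rV['F_2]_2) :
  dH p q = if (p \in Pe) (+) (q \in Pe) then 1%N else if p == q then 0%N else 2%N.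
Proof.
have -> : (p == q) = (p 0 0 == q 0 0) && (p 0 1 == q 0 1).
  by apply/eqP/andP => [->//|[/eqP ? /eqP ?]]; apply: rV2P.
rewrite dH_rV2 !mem_Pe.
by case: (F2P (p 0 0)) (F2P (p 0 1)) (F2P (q 0 0)) (F2P (q 0 1)) => -> [] -> [] -> [] ->.
Qed.

Lemma bcompl_Pe (p : 'rV['F_2]_2) : (bcompl p \in Pe) = (p \in Pe).
Proof. by rewrite !mem_Pe !mxE (inj_eq (addIr 1)). Qed.

Lemma bcompl_neq (p : 'rV['F_2]_2) :
  ((bcompl p == p) = false) * ((p == bcompl p) = false).
Proof.
have bp : (bcompl p == p) = false.
  apply/eqP => /rowP/(_ 0); rewrite mxE => /eqP.
  by rewrite -subr_eq0 addrAC subrr add0r.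
by split; rewrite // eq_sym.
Qed.

Lemma bcompl_inj N : injective (@bcompl N).
Proof. by move=> p q /rowP e; apply/rowP => i; have := e i; rewrite !mxE => /addIr. Qed.

(** * How [N2] depends on the assignment to odd codewords *)

Section Count.
Variables (n : nat) (H : 'M['F_2]_(n, 2 ^ n - 1)).
Hypothesis hH : hamming_check H.
Let C := code H.
Variables (S S' : {set 'rV['F_2]_2}) (s : bool).
Hypothesis SE : forall p, (p \in S) = ((p \in Pe) == s).
Hypothesis S'E : forall p, (p \in S') = ((p \in Pe) == ~~ s).
Variables (a : 'rV['F_2]_(2 ^ n - 1) -> 'rV['F_2]_2).
Hypothesis aS : assignment (even_part C) S a.

Let near x := nearest C x.

Lemma odd_partE x : x \in C -> (x \in odd_part C) = (x \notin even_part C).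
Proof. by move=> Cx; rewrite !inE negb_and negbK; move: Cx; rewrite inE => ->. Qed.

Lemma parityE b x : parity C a b x =
  if x \in C then code_parity C a b (near x) else bcompl (code_parity C a b (near x)).
Proof. by rewrite /parity; case: ifP => // Cx; rewrite /near nearest_id. Qed.

(** Complementing both bits preserves the class, so the class of a parity is determined by the
    nearest codeword alone, independently of the values of [b]. *)
Lemma parity_Pe b x : assignment (odd_part C) S' b ->
  (parity C a b x \in Pe) = ((near x \in even_part C) == s).
Proof.
move=> bS; have -> : (parity C a b x \in Pe) = (code_parity C a b (near x) \in Pe).
  by rewrite parityE; case: ifP; rewrite ?bcompl_Pe.
rewrite /code_parity; case: ifPn => ne.
  by have := aS ne; rewrite SE => /eqP ->; case: s.
rewrite -odd_partE ?nearest_code// in ne.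
by have := bS _ ne; rewrite S'E => /eqP ->; case: s.
Qed.

Definition odd_distinct x y :=
  [&& near x \in odd_part C, near y \in odd_part C & near x != near y].

(** Two even nearest codewords take their parities from [a]. One even and one odd give parities in
    different classes, always at distance 1. A shared odd nearest codeword gives equal or
    complementary parities, according to which of the two words are codewords. *)
Lemma dH_Enc_indep b b' x y :
  assignment (odd_part C) S' b -> assignment (odd_part C) S' b' ->
  ~~ odd_distinct x y ->
  dH (Enc C a b x) (Enc C a b y) = dH (Enc C a b' x) (Enc C a b' y).
Proof.
move=> bS bS' nod; rewrite /Enc !dH_row_mx !dH_parity !parity_Pe//; congr addn.
have [ex|ox] := boolP (near x \in even_part C);
  have [ey|oy] := boolP (near y \in even_part C); rewrite ?addbb //=.
- by rewrite !parityE /code_parity ex ey.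
- by case: s.
- by case: s.
have/eqP exy : near x == near y.
  move: nod; rewrite /odd_distinct !odd_partE ?nearest_code// ox oy /=.
  by rewrite negbK.
rewrite !parityE -exy /code_parity (negbTE ox).
by case: (x \in C); case: (y \in C); rewrite ?eqxx ?bcompl_neq.
Qed.

Lemma odd_dH_even x y : x \in odd_part C -> y \in odd_part C ->
  ~~ odd (dH x y).
Proof. by rewrite !inE => /andP[_ ox] /andP[_ oy]; rewrite dHE odd_weightD ox oy. Qed.

Lemma odd_distinct_dH x y : odd_distinct x y -> (3 < dH (near x) (near y))%N.
Proof.
move=> /and3P[ox oy xy]; have := odd_dH_even ox oy.
have : (2 < dH (near x) (near y))%N.
  by rewrite ltnNge; apply: contra_neqN xy; apply: (hamming_dH hH); apply: nearest_code.
by rewrite leq_eqVlt => /orP[/eqP <-|].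
Qed.

Lemma near_dH x : (dH x (near x) <= 1)%N.
Proof. by have := nearestE x (near x) hH; rewrite eqxx => /esym/andP[]. Qed.

(** Both parities lie in one class, so they are at distance 0 or 2, and [x != y] leaves only
    distance 2 with equal parities. As the nearest codewords are at least 4 apart, [dH x y] being 2
    forces both words to be non-codewords, and the two complements cancel. *)
Lemma dH_Enc_odd_distinct b x y : assignment (odd_part C) S' b ->
  odd_distinct x y ->
  (dH (Enc C a b x) (Enc C a b y) == 2%N) = (dH x y == 2%N) && (b (near x) == b (near y)).
Proof.
move=> bS od; have := odd_distinct_dH od; have [ox oy xy] := and3P od.
have nx := near_dH x; have ny := near_dH y => d4.
have t1 := dH_triangle (near x) x (near y); have t2 := dH_triangle x y (near y).
rewrite (dHC (near x) x) in t1.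
have xy0 : dH x y != 0%N.
  by rewrite dH_eq0; apply: contraNneq xy => ->.
rewrite /Enc dH_row_mx dH_parity !parity_Pe//.
move: ox oy; rewrite !odd_partE ?nearest_code// => ox oy.
rewrite (negbTE ox) (negbTE oy) addbb.
have [d2|d2] := eqVneq (dH x y) 2%N; last by case: ifP; move: xy0 d2; lia.
have nC z : dH z (near z) != 0%N -> z \notin C.
  by rewrite dH_eq0; apply: contra => Cz; rewrite /near nearest_id.
have xC : x \notin C by apply: nC; lia.
have yC : y \notin C by apply: nC; lia.
rewrite d2 !parityE (negbTE xC) (negbTE yC) /code_parity (negbTE ox) (negbTE oy).
by rewrite (inj_eq (@bcompl_inj _)); case: ifP.
Qed.

(* Ordered pairs: every unordered pair is counted twice, as in [N2_agreements]. *)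
Definition agreements (b : 'rV['F_2]_(2 ^ n - 1) -> 'rV['F_2]_2) : nat :=
  (\sum_(c in odd_part C) \sum_(c' in odd_part C)
     (dH c c' == 4) * (b c == b c'))%N.

Lemma count_odd_distinct b : assignment (odd_part C) S' b ->
  (\sum_x \sum_(y | odd_distinct x y) (dH (Enc C a b x) (Enc C a b y) == 2) =
   12 * agreements b)%N.
Proof.
move=> bS.
transitivity (\sum_(x | near x \in odd_part C) \sum_(y | near y \in odd_part C)
  (near x != near y) * ((dH x y == 2) * (b (near x) == b (near y))))%N.
  rewrite [RHS]big_mkcond; apply: eq_bigr => x _; case: ifPn => ox; last first.
    by rewrite big_pred0// => y; rewrite /odd_distinct (negbTE ox).
  rewrite big_mkcond [RHS]big_mkcond; apply: eq_bigr => y _.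
  have := @dH_Enc_odd_distinct b x y bS; rewrite /odd_distinct ox /=.
  case: (near y \in odd_part C) => //=.
  by case: eqP => //= _ /(_ isT) ->; rewrite mulnb mul1n.
rewrite (partition_big near (mem (odd_part C))) //= /agreements big_distrr /=.
apply: eq_bigr => c oc; rewrite big_distrr /= exchange_big /=.
rewrite (partition_big near (mem (odd_part C))) //=.
apply: eq_bigr => c' oc'.
have [Cc Cc'] : c \in C /\ c' \in C.
  by move: oc oc'; rewrite !inE => /andP[-> _] /andP[-> _].
(* With both nearest codewords fixed, the parity condition is constant and factors out; what remains
   counts pairs at distance 2 between two radius-1 balls. *)
transitivity ((c != c') * (b c == b c') *
  \sum_(t | (dH t c' <= 1)%N) \sum_(u | (dH u c <= 1)%N) (dH u t == 2))%N.
  rewrite !big_distrr /=; apply: eq_big => [y|y /andP[_ /eqP ny]].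
    rewrite -[RHS]andTb -Cc' -nearestE// -/C -/(near y).
    by case: (near y =P c') => [->|]; rewrite ?oc' ?andbF.
  rewrite big_distrr /=; apply: eq_big => [x|x /andP[_ /eqP nx]].
    rewrite -[RHS]andTb -Cc -nearestE// -/C -/(near x).
    by case: (near x =P c) => [->|]; rewrite ?oc ?andbF.
  by rewrite nx ny mulnA mulnAC.
have [->|cc'] := eqVneq c c'.
  by rewrite (_ : (dH c' c' == 4%N) = false) // (eqP (_ : dH c' c' == 0%N)) ?dH_eq0.
have dcc' : (2 < weight (c' + c)%R)%N.
  by rewrite -dHE dHC ltnNge; apply: contra_neqN cc'; exact: (hamming_dH hH).
have ecc' : ~~ odd (weight (c' + c)) by rewrite -dHE; apply: odd_dH_even.
suff -> : (\sum_(t | (dH t c' <= 1)%N) \sum_(u | (dH u c <= 1)%N) (dH u t == 2) =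
  12 * (dH c c' == 4))%N by rewrite mul1n mulnCA (mulnC (dH c c' == 4%N)).
(* Both balls are recentred at 0, which turns the distance into the weight of [c' + c] plus two
   error words. *)
rewrite [in RHS]dHC [in RHS]dHE -count_weight4// (reindex_inj (addrI c')) /=.
apply: eq_big => [y|y _]; first by rewrite dHE addrC rVF2_addrK.
rewrite (reindex_inj (addrI c)) /=.
apply: eq_big => [x|x _]; first by rewrite dHE addrC rVF2_addrK.
by rewrite dHE addrACA (addrC c) (addrC x) addrA.
Qed.

(** Pairs outside [odd_distinct] contribute the same amount for [b] and [b']. The difference of the
    two counts is stated additively to stay within the natural numbers. *)
Lemma N2_agreements b b' :
  assignment (odd_part C) S' b -> assignment (odd_part C) S' b' ->
  (N2 C a b * 2 + 12 * agreements b' = N2 C a b' * 2 + 12 * agreements b)%N.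
Proof.
move=> bS bS'.
pose G b := (\sum_x \sum_(y | ~~ odd_distinct x y)
  (dH (Enc C a b x) (Enc C a b y) == 2))%N.
have N2E b0 : assignment (odd_part C) S' b0 ->
    (N2 C a b0 * 2 = 12 * agreements b0 + G b0)%N.
  move=> bS0; rewrite -count_odd_distinct// /G -big_split /= /N2.
  rewrite (card_edges (r := fun x y => dH (Enc C a b0 x) (Enc C a b0 y) == 2%N)).
  - by apply: eq_bigr => x _; rewrite (bigID (odd_distinct x)).
  - by move=> x y /=; rewrite dHC.
  - move=> x /=; apply/eqP => e; have := dH_eq0 (Enc C a b0 x) (Enc C a b0 x).
    by rewrite e eqxx.
have GE : G b = G b'.
  apply: eq_bigr => x _; apply: eq_bigr => y nod.
  by rewrite (dH_Enc_indep bS bS' nod).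
by rewrite !N2E// GE; lia.
Qed.

End Count.

(** The boolean is true when [S] is [Pe] and false when it is [Po], so both choices of classes are
    handled by one argument. *)
Lemma parity_classesP (S S' : {set 'rV['F_2]_2}) :
  [set S; S'] = [set Pe; Po] ->
  exists s, (forall p, (p \in S) = ((p \in Pe) == s)) /\
            (forall p, (p \in S') = ((p \in Pe) == ~~ s)).
Proof.
have PoPe : Po != Pe.
  apply/eqP => /setP/(_ (const_mx 0)).
  by rewrite mem_Po mem_Pe !mxE eqxx.
have PoE p : (p \in Po) = ((p \in Pe) == false) by rewrite mem_Po eqbF_neg.
have PeE p : (p \in Pe) = ((p \in Pe) == true) by rewrite eqb_id.
move=> /setP e.
have := e S; have := e S'; have := e Pe; have := e Po; rewrite !inE !eqxx !orbT /=.
move=> ePo ePe /esym/orP[]/eqP S'E /esym/orP[]/eqP SE; rewrite SE S'E;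
  move: ePo ePe; rewrite SE S'E.
- by rewrite orbb (negbTE PoPe).
- by exists false.
- by exists true.
- by rewrite orbb eq_sym (negbTE PoPe).
Qed.

(** * From parity assignments to cut vectors *)

Definition sign_vec (R : realType) N m (w : 'I_m -> 'rV['F_2]_N)
    (b : 'rV['F_2]_N -> 'rV['F_2]_2) (p : 'rV['F_2]_2) : 'cV[R]_m :=
  \col_i (if b (w i) == p then 1 else -1).

(** For signs, twice the indicator of [z_i = z_j] is [1 + z_i z_j]; summing over adjacent pairs
    gives the identity. *)
Lemma agreements_qform (R : realType) n (H : 'M['F_2]_(n, 2 ^ n - 1))
    (w : 'I_#|odd_part (code H)| -> 'rV['F_2]_(2 ^ n - 1)) b p :
  ordering_of w -> assignment (odd_part (code H)) [set p; bcompl p] b ->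
  (agreements H b)%:R * 2 =
  \sum_i \sum_j adj4 R w i j + qform (adj4 R w) (sign_vec R w b p).
Proof.
move=> [wI wE] bp.
have sum_w (F : _ -> nat) :
    (\sum_(c in odd_part (code H)) F c = \sum_i F (w i))%N.
  by rewrite -{1}wE big_imset //= => ? ? _ _; apply: wI.
have -> : (agreements H b)%:R =
    \sum_i \sum_j (adj4 R w i j * (b (w i) == b (w j))%:R).
  rewrite /agreements sum_w natr_sum; apply: eq_bigr => i _.
  rewrite sum_w natr_sum; apply: eq_bigr => j _.
  by rewrite natrM mxE.
have -> : qform (adj4 R w) (sign_vec R w b p) = \sum_i \sum_j
    (adj4 R w i j * (sign_vec R w b p i 0 * sign_vec R w b p j 0)).
  rewrite /qform -mulmxA mxE; apply: eq_bigr => i _.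
  rewrite !mxE big_distrr /=; apply: eq_bigr => j _.
  by rewrite !mxE mulrCA.
rewrite mulr_suml -big_split /=; apply: eq_bigr => i _.
rewrite mulr_suml -big_split /=; apply: eq_bigr => j _.
rewrite -mulrA -[X in _ = X + _]mulr1 -mulrDr; congr (_ * _).
have bw k : b (w k) = p \/ b (w k) = bcompl p.
  have : b (w k) \in [set p; bcompl p] by apply: bp; rewrite -wE; apply: imset_f.
  by rewrite !inE => /orP[]/eqP; auto.
rewrite !mxE; case: (bw i) => ->; case: (bw j) => ->;
  rewrite ?eqxx ?bcompl_neq /=; lra.
Qed.

Lemma sign_vec_cut (R : realType) N m (w : 'I_m -> 'rV['F_2]_N) b p :
  cut_vector (sign_vec R w b p).
Proof. by move=> i; rewrite mxE; case: eqP; auto. Qed.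

Lemma qform_min_optimal (R : realType) (n : nat) (H : 'M['F_2]_(n, 2 ^ n - 1))
    (w : 'I_#|odd_part (code H)| -> 'rV['F_2]_(2 ^ n - 1))
    (z : 'cV[R]_#|odd_part (code H)|)
    (S S' : {set 'rV['F_2]_2}) (p : 'rV['F_2]_2) b :
  hamming_check H -> ordering_of w -> cut_vector z ->
  (forall y, cut_vector y -> qform (adj4 R w) z <= qform (adj4 R w) y) ->
  [set S; S'] = [set Pe; Po] -> [set p; bcompl p] = S' ->
  (forall i, b (w i) = if z i 0 == 1 then p else bcompl p) ->
  optimal_odd (code H) S S' b.
Proof.
move=> hH hw zc zmin /parity_classesP[s [SE S'E]] S'p bz.
have bS : assignment (odd_part (code H)) S' b.
  move=> c; rewrite -hw.2 => /imsetP[i _ ->].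
  by rewrite -S'p bz !inE; case: ifP; rewrite eqxx ?orbT.
split=> // b' a b'S aS.
have := N2_agreements hH SE S'E aS bS b'S.
suff : (agreements H b <= agreements H b')%N by lia.
rewrite -(ler_nat R) -(ler_pM2r (ltr0n R 2)).
rewrite -S'p in bS b'S; rewrite !(@agreements_qform R _ _ w _ p)// lerD2l.
(* The competitor [b'] also defines a cut vector, so minimality of [z] applies once [b] is seen to
   encode [z] itself. *)
suff -> : sign_vec R w b p = z by apply/zmin/sign_vec_cut.
apply/colP => i; rewrite mxE bz.
case: (zc i) => ->; first by rewrite !eqxx.
by rewrite (_ : (-1 == 1 :> R) = false) ?bcompl_neq //; apply/eqP; lra.
Qed.

Theorem theorem7 (R : realType) (n : nat) (hn : (2 <= n)%N)
    (H : 'M['F_2]_(n, 2 ^ n - 1)) (hH : hamming_check H)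
    (v : 'I_#|even_part (code H)| -> 'rV['F_2]_(2 ^ n - 1))
    (hv : ordering_of v)
    (w : 'I_#|odd_part (code H)| -> 'rV['F_2]_(2 ^ n - 1))
    (hw : ordering_of w)
    (w' : 'rV['F_2]_(2 ^ n - 1)) (hw' : w' \in odd_part (code H)) :
  let A := adj4 R v in
  let A' := adj4 R w in
  let P := shift_mx R v w w' in
  let Q := range (char_vec R v) in
  let Q' := [set P *m e | e in Q]%classic in
  [/\ orthogonal_eigenvectors A Q,
      orthogonal_eigenvectors A' Q',
      exists lmin, min_eigenvalue A lmin,
      forall lmin, min_eigenvalue A lmin <-> min_eigenvalue A' lmin
    & forall lmin, min_eigenvalue A lmin ->
      forall e', Q' e' -> A' *m e' = lmin *: e' ->
      forall z, z = e' \/ z = - e' ->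
      [/\ cut_vector z,
          forall y, cut_vector y -> qform A' z <= qform A' y
        & forall (S S' : {set 'rV['F_2]_2}) (p' : 'rV['F_2]_2)
            (b : 'rV['F_2]_(2 ^ n - 1) -> 'rV['F_2]_2),
          [set S; S']%SET = [set Pe; Po]%SET ->
          [set p'; bcompl p']%SET = S' ->
          (forall i, b (w i) = if z i 0 == 1 then p' else bcompl p') ->
          optimal_odd (code H) S S' b]].
Proof.
move=> A A' P Q Q'.
have vC := even_part_regular hv; have wC := odd_part_regular hw.
have [vI vE] := hv; have [wI wE] := hw.
have vD k : v k \in even_part (code H) by rewrite -vE; apply: imset_f.
have wD k : w k \in odd_part (code H) by rewrite -wE; apply: imset_f.
have vw k : v k + w' \in [set w i | i : 'I_#|odd_part (code H)|].
  by rewrite wE addr_odd_part.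
have wv i : w i + w' \in [set v k | k : 'I_#|even_part (code H)|].
  by rewrite vE addr_odd_part_even.
have m0 : (0 < #|even_part (code H)|)%N.
  (* The witness [w' + w'] is the zero word. *)
  by apply/card_gt0P; exists (w' + w'); rewrite addr_odd_part_even.
have m0' : (0 < #|odd_part (code H)|)%N by apply/card_gt0P; exists w'.
have PE u : P *m char_vec R v u = chi R u w' *: char_vec R w u.
  exact: shift_mx_char_vec.
have Qorth u t : char_vec R v u != char_vec R v t ->
    (char_vec R v u)^T *m char_vec R v t = 0.
  by apply: char_vec_orthogonal => // k x; rewrite vE even_partD.
have eigenA' u : A' *m (P *m char_vec R v u) =
    weight4_eigenvalue R (code H) u *: (P *m char_vec R v u).
  by rewrite PE -scalemxAr (adj4_char_vec R wC) !scalerA mulrC.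
(* Both conditions reduce to the same statement about [weight4_eigenvalue], in which the ordering no
   longer appears. *)
have minE l : min_eigenvalue A l <-> min_eigenvalue A' l.
  by rewrite (min_eigenvalue_adj4P vC)// (min_eigenvalue_adj4P wC).
split=> //.
- split=> [_ [u _ <-]|_ _ [u _ <-] [t _ <-]]; last exact: Qorth.
  split; first exact: char_vec_neq0.
  by exists (weight4_eigenvalue R (code H) u); apply: adj4_char_vec.
- split=> [_ [_ [u _ <-] <-]|_ _ [_ [u _ <-] <-] [_ [t _ <-] <-] ut].
    split; last by exists (weight4_eigenvalue R (code H) u).
    rewrite PE scaler_eq0 negb_or char_vec_neq0 // andbT.
    by case: (chi_pm1 R u w') => ->; rewrite ?oppr_eq0 oner_neq0.
  rewrite trmx_mul mulmxA -(mulmxA _ P^T) shift_mx_isometry // mulmx1.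
  by apply: Qorth; apply: contraNneq ut => ->.
- have [u _ umin] := arg_minP (weight4_eigenvalue R (code H))
    (isT : xpredT (0 : 'rV['F_2]_(2 ^ n - 1))).
  exists (weight4_eigenvalue R (code H) u); apply/(min_eigenvalue_adj4P vC) => //.
  by split=> [|t]; [exists u | exact: umin].
move=> l lmin _ [_ [u _ <-] <-] A'e z ze.
have lle : forall t, l <= weight4_eigenvalue R (code H) t.
  by have /(min_eigenvalue_adj4P vC _ m0)[] := lmin.
(* Each entry of [z] is a product of signs: the global one from [w'], the character value, and
   possibly the negation. *)
have zc : cut_vector z.
  move=> i; case: ze => ->; rewrite PE !mxE -/(chi R u (w i));
  by case: (chi_pm1 R u w') => ->; case: (chi_pm1 R u (w i)) => ->;
    rewrite ?mulrNN ?mulr1 ?mul1r ?opprK; auto.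
have A'z : A' *m z = l *: z.
  by case: ze => -> //; rewrite mulmxN A'e scalerN.
(* All cut vectors have the same squared norm, so the Rayleigh bound, attained at [z], compares the
   quadratic forms directly. *)
have zmin y : cut_vector y -> qform A' z <= qform A' y.
  move=> yc; rewrite (qform_eigen A'z) (cut_vector_sqr zc) -(cut_vector_sqr yc).
  exact: (qform_adj4_ge wC).
by split=> // S S' p b; apply: qform_min_optimal hw zc zmin.
Qed.
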